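(* For any lattice $\mathcal{L} \subset \mathbb{R}^n$ and vectors $\mathbf{u},\mathbf{v} \in \mathbb{R}^n$, \[ \mathbb{E}_{\mathbf{y} \sim D_{\mathcal{L}}}[\langle\mathbf{y},\mathbf{u}\rangle^2\langle\mathbf{y},\mathbf{v}\rangle^2] \geq \mathbb{E}_{\mathbf{y} \sim D_{\mathcal{L}}}[\langle\mathbf{y}, \mathbf{u}\rangle^2 ]\;\mathbb{E}_{\mathbf{y} \sim D_{\mathcal{L}}}[\langle\mathbf{y}, \mathbf{v}\rangle^2 ] + 2\big(\mathbb{E}_{\mathbf{y} \sim D_{\mathcal{L}}}[\langle\mathbf{y},\mathbf{u}\rangle\langle\mathbf{y},\mathbf{v}\rangle]\big)^2 . \]
   Context: A lattice $\mathcal{L}\subset\mathbb{R}^n$ is the set of all integer linear combinations of $n$ linearly independent vectors of $\mathbb{R}^n$. For $\mathbf{x}\in\mathbb{R}^n$, $\rho(\mathbf{x}) = \exp(-\pi \|\mathbf{x}\|^2)$ with $\|\cdot\|$ the Euclidean norm, and for a discrete set $A\subset\mathbb{R}^n$, $\rho(A) = \sum_{\mathbf{w}\in A}\rho(\mathbf{w})$. The discrete Gaussian distribution $D_{\mathcal{L}}$ is the probability distribution on $\mathcal{L}$ assigning probability $\rho(\mathbf{w})/\rho(\mathcal{L})$ to each $\mathbf{w}\in\mathcal{L}$. $\langle\cdot,\cdot\rangle$ is the standard inner product. *)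

(* Defs.v *)
From HB Require Import structures.
From mathcomp Require Import all_boot all_order all_algebra.
From mathcomp Require Import all_classical all_reals all_analysis.

Set Implicit Arguments.
Unset Strict Implicit.
Unset Printing Implicit Defensive.

Import Order.TTheory GRing.Theory Num.Theory.
Import numFieldNormedType.Exports.

Local Open Scope classical_set_scope.
Local Open Scope ring_scope.

Definition dotv (R : realType) (n : nat) (x y : 'rV[R]_n) : R :=
  \sum_(i < n) x 0 i * y 0 i.

(* The library norm `|x| on 'rV[R]_n is the sup norm, hence this one. *)
Definition enorm (R : realType) (n : nat) (x : 'rV[R]_n) : R :=
  Num.sqrt (dotv x x).

Definition is_lattice (R : realType) (n : nat) (L : set 'rV[R]_n) : Prop :=
  exists2 b : n.-tuple 'rV[R]_n, free b &
    L = [set \sum_(i < n) tnth b i *~ z i | z in [set: 'I_n -> int]].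

(* R^n with the sigma-algebra of all subsets, so that distributions with
   countable support need no measurability side conditions. *)
Definition discrete_rV (R : realType) (n : nat) : Type := 'rV[R]_n.

HB.instance Definition _ (R : realType) (n : nat) :=
  Pointed.copy (discrete_rV R n) 'rV[R]_n.
HB.instance Definition _ (R : realType) (n : nat) :=
  @isMeasurable.Build default_measure_display (discrete_rV R n)
    discrete_measurable discrete_measurable0
    discrete_measurableC discrete_measurableU.

Lemma measurable_discrete_rV (R : realType) (n : nat)
  (A : set (discrete_rV R n)) : measurable A.
Proof. by []. Qed.

Definition rho (R : realType) (n : nat) (x : 'rV[R]_n) : R :=
  expR (- (pi * enorm x ^+ 2)).

Definition rho_set (R : realType) (n : nat) (A : set (discrete_rV R n)) :
  \bar R := \esum_(w in A) (rho w)%:E.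

Section rho_set_measure.
Context (R : realType) (n : nat).
Local Open Scope ereal_scope.

Let rho_set0 : @rho_set R n set0 = 0.
Proof. exact: esum_set0. Qed.

Let rho_set_ge0 (A : set (discrete_rV R n)) : 0 <= rho_set A.
Proof. by apply: esum_ge0 => w _; rewrite lee_fin expR_ge0. Qed.

Let rho_set_sigma_additive : semi_sigma_additive (@rho_set R n).
Proof.
move=> F _ tF _; apply: cvg_toP.
  by apply: is_cvg_nneseries => k _ _; exact: rho_set_ge0.
rewrite nneseries_esumT; last by move=> k; exact: rho_set_ge0.
rewrite /rho_set esum_bigcupT// => w.
by rewrite lee_fin expR_ge0.
Qed.

HB.instance Definition _ := isMeasure.Build _ (discrete_rV R n) R
  (@rho_set R n) rho_set0 rho_set_ge0 rho_set_sigma_additive.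

End rho_set_measure.

(* mrestr restricts the measure rho_set to L, and mnormalize divides it by its
   total mass rho(L).  The mass of a lattice is positive and finite; the Dirac
   measure is only the default that mnormalize uses for mass 0 or +oo. *)
Definition discrete_gaussian (R : realType) (n : nat)
    (L : set (discrete_rV R n)) : probability (discrete_rV R n) R :=
  mnormalize (mrestr (@rho_set R n) (measurable_discrete_rV L))
    (@dirac _ (discrete_rV R n) (0 : 'rV[R]_n) R).

(* Main.v *)
Require Import Defs.
From mathcomp Require Import all_boot all_order all_algebra.
From mathcomp Require Import all_classical all_reals all_analysis.
From mathcomp Require Import measurable_realfun ring lra zify.

Set Implicit Arguments.
Unset Strict Implicit.
Unset Printing Implicit Defensive.

Import Order.TTheory GRing.Theory Num.Theory.
Import numFieldNormedType.Exports.

Local Open Scope classical_set_scope.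
Local Open Scope ring_scope.

(* Let x, y be independent samples of the discrete Gaussian on L, and put
   a = x + y, b = x - y.  Up to normalization (a, b) has weight
   exp(-pi |a|^2 / 2) exp(-pi |b|^2 / 2) on the pairs of L^2 that are congruent
   mod 2L, so for every function g the expectation of g(a) g(b) is a sum of
   squares, one for each class of L mod 2L, hence nonnegative.  For
   g(a) = <a,u><a,v> - m with m = 2 E[<x,u><x,v>], expanding in x and y gives
     E[g(a) g(b)] = 2 E[<x,u>^2 <x,v>^2] - 2 E[<x,u>^2] E[<x,v>^2]
                    - 4 E[<x,u><x,v>]^2.
   The regrouping into classes is carried out on finite sums and passed to the
   limit by dominated convergence. *)

(** * Inner product and Gaussian weight on R^n *)

Section inner_product.
Context (R : realType) (n : nat).
Implicit Types (x y z : 'rV[R]_n).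

Lemma dotvC x y : dotv x y = dotv y x.
Proof. by apply: eq_bigr => i _; rewrite mulrC. Qed.

Lemma dotvDl x y z : dotv (x + y) z = dotv x z + dotv y z.
Proof.
by rewrite -big_split; apply: eq_bigr => i _; rewrite mxE mulrDl.
Qed.

Lemma dotvZl (a : R) x z : dotv (a *: x) z = a * dotv x z.
Proof. by rewrite mulr_sumr; apply: eq_bigr => i _; rewrite mxE mulrA. Qed.

Lemma dotvBl x y z : dotv (x - y) z = dotv x z - dotv y z.
Proof. by rewrite dotvDl -scaleN1r dotvZl mulN1r. Qed.

Lemma dotv_ge0 x : 0 <= dotv x x.
Proof. by apply: sumr_ge0 => i _; rewrite -expr2 sqr_ge0. Qed.

Lemma dotv_CauchySchwarz x y : dotv x y ^+ 2 <= dotv x x * dotv y y.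
Proof.
have [y0|yn0] := eqVneq (dotv y y) 0.
  have y_eq0 : y = 0.
    apply/rowP => i; rewrite mxE; apply/eqP; rewrite -sqrf_eq0 expr2.
    apply/eqP/(psumr_eq0P _ y0) => // j _.
    by rewrite -expr2 sqr_ge0.
  by rewrite y0 mulr0 y_eq0 dotvC -(scale0r 0) dotvZl mul0r expr0n.
have y_gt0 : 0 < dotv y y by rewrite lt_neqAle eq_sym yn0 dotv_ge0.
(* The squared length of this vector is [dotv y y] times the difference of the two sides of the
   claim. *)
have := dotv_ge0 (dotv y y *: x - dotv x y *: y).
rewrite dotvBl !dotvZl !(dotvC _ (_ - _)) !dotvBl !dotvZl (dotvC y x) => h.
rewrite -(ler_pM2l y_gt0) -subr_ge0; apply: le_trans h _.
by rewrite le_eqVlt; apply/orP; left; apply/eqP; ring.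
Qed.

Lemma dotv_parallelogram x y :
  dotv (x + y) (x + y) + dotv (x - y) (x - y) = 2 * (dotv x x + dotv y y).
Proof.
rewrite dotvDl dotvBl !(dotvC _ (_ + _)).
by rewrite !(dotvBl, dotvDl) (dotvC y x); ring.
Qed.

Lemma rhoE x : rho x = expR (- (pi * dotv x x)).
Proof. by rewrite /rho /enorm sqr_sqrtr// dotv_ge0. Qed.

Lemma rho_gt0 x : 0 < rho x.
Proof. exact: expR_gt0. Qed.

End inner_product.

(** * Uniform bounds for sums over boxes of integers *)

Section summability.
Context (R : realType).

Lemma sum_inv1Dsqr_le N : \sum_(j < N) (1 + (j%:R : R) ^+ 2)^-1 <= 4.
Proof.
(* The sharper bound telescopes: its increment is 4 / ((N + 1)(N + 2)), and (N + 1)(N + 2) <= 4 (1 +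
   N^2) for every N. *)
suff : \sum_(j < N) (1 + (j%:R : R) ^+ 2)^-1 <= 4 - 4 / N.+1%:R.
  by move/le_trans; apply; rewrite gerBl divr_ge0.
elim: N => [|N IHN]; first by rewrite big_ord0 divr1 subrr.
rewrite big_ord_recr/=; apply: le_trans (lerD IHN (lexx _)) _.
have x0 : 0 <= N%:R :> R by [].
rewrite -[N.+2%:R]natr1 -[N.+1%:R]natr1; set x : R := N%:R in x0 *.
have -> : 4 - 4 / (x + 1 + 1) =
    4 - 4 / (x + 1) + 4 / ((x + 1) * (x + 1 + 1)).
  by field; apply/andP; split; lra.
rewrite lerD2l -[leRHS]invf_div lef_pV2 ?posrE; first by nra.
- by nra.
- by rewrite divr_gt0// mulr_gt0//; lra.
Qed.

Lemma sum_centered_inv1Dsqr_le N :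
  \sum_(k < N + N) (1 + ((k%:Z - N%:Z)%:~R : R) ^+ 2)^-1 <= 8.
Proof.
have -> : 8 = 4 + 4 :> R by lra.
rewrite big_split_ord/=; apply: lerD; last first.
  apply: le_trans (sum_inv1Dsqr_le N); apply: ler_sum => i _.
  have -> : (N + i)%:Z - N%:Z = i%:Z by rewrite PoszD addrAC subrr add0r.
  by [].
(* After reversal the negative half takes the values -(i + 1), and each such term is at most the
   term at i. *)
rewrite (reindex_inj rev_ord_inj)/=.
apply: le_trans (sum_inv1Dsqr_le N); apply: ler_sum => i _.
have -> : (N - i.+1)%:Z - N%:Z = - i.+1%:Z 
  by rewrite -subzn// addrAC subrr add0r.
rewrite lef_pV2 ?posrE ?ltr_pwDl ?sqr_ge0//.
rewrite mulrNz sqrrN lerD2l ler_pXn2r ?nnegrE//.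
by rewrite ler_nat.
Qed.

(** By distributivity the sum over the box is the n-th power of the centered one-dimensional sum, so
    the bound does not depend on [N]. *)
Lemma sum_box_inv1Dsqr_le n N :
  \sum_(A : {ffun 'I_n -> 'I_(N + N)})
    \prod_(i < n) (1 + (((A i)%:Z - N%:Z)%:~R : R) ^+ 2)^-1 <= 8 ^+ n.
Proof.
rewrite -(bigA_distr_bigA (fun (i : 'I_n) (k : 'I_(N + N)) =>
  (1 + ((k%:Z - N%:Z)%:~R : R) ^+ 2)^-1)).
rewrite prodr_const card_ord lerXn2r ?nnegrE ?sum_centered_inv1Dsqr_le//.
by apply: sumr_ge0 => k _; rewrite invr_ge0 addr_ge0 ?sqr_ge0.
Qed.

(** With a = pi / (m + 1), taking roots of order m + 1 leaves a linear estimate: 1 + c t <= (1 + c /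
    a)(1 + a t) <= (1 + c / a) exp(a t). *)
Lemma exprn_le_expR (c : R) (m : nat) : 0 <= c ->
  exists2 K : R, 0 <= K &
    forall t, 0 <= t -> (1 + c * t) ^+ m.+1 <= K * expR (pi * t).
Proof.
move=> c0; pose a : R := pi / m.+1%:R.
have a0 : 0 < a by rewrite divr_gt0 ?pi_gt0.
exists ((1 + c / a) ^+ m.+1) => [|t t0].
  by rewrite exprn_ge0// addr_ge0// divr_ge0// ltW.
have -> : pi * t = m.+1%:R * (a * t) by rewrite /a; field.
rewrite expRM_natl -exprMn lerXn2r ?nnegrE//.
- by rewrite addr_ge0// mulr_ge0.
- by rewrite mulr_ge0 ?expR_ge0// addr_ge0// divr_ge0// ltW.
apply: (@le_trans _ _ ((1 + c / a) * (1 + a * t))).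
  have an0 : a != 0 by rewrite gt_eqF.
  have -> : (1 + c / a) * (1 + a * t) = 1 + c * t + (c / a + a * t) by field.
  rewrite lerDl; apply: addr_ge0; first by apply: divr_ge0 => //; exact: ltW.
  by apply: mulr_ge0 => //; exact: ltW.
by rewrite ler_wpM2l ?expR_ge1Dx// addr_ge0// divr_ge0// ltW.
Qed.

End summability.

(** Grouping the entries of [s] by class turns the double sum into the sum, over the classes, of the
    square of the total of [G] on the class. *)
Lemma equiv_quadratic_ge0 (R : realType) (T : eqType) (s : seq T) (e : rel T)
    (G : T -> R) : equivalence_rel e ->
  0 <= \sum_(a <- s) \sum_(b <- s) (e a b)%:R * (G a * G b).
Proof.
(* The label of a class is the position in [s] of its first representative, so the classes can be
   indexed by [k < size s]. *)
move=> e_equiv; pose cl a := find (e a) s.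
have clP a : a \in s -> (cl a < size s)%N /\ e a (nth a s (cl a)).
  move=> sa; have has_a : has (e a) s by apply/hasP; exists a; rewrite ?e_equiv.
  by rewrite -has_find; split; last exact: nth_find.
have eE a b : a \in s -> b \in s -> e a b = (cl a == cl b).
  move=> sa sb; apply/idP/eqP => [eab|clab].
    by apply: eq_find => c; exact: (e_equiv a b c).2.
  have [cla ea] := clP a sa; have [clb eb] := clP b sb.
  rewrite (set_nth_default a) -?clab// in eb.
  rewrite ((e_equiv a (nth a s (cl a)) b).2 ea).
  by rewrite -((e_equiv b (nth a s (cl a)) b).2 eb) (e_equiv b b b).1.
have -> : \sum_(a <- s) \sum_(b <- s) (e a b)%:R * (G a * G b) =
    \sum_(k < size s) (\sum_(a <- s) (cl a == k)%:R * G a) ^+ 2.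
  under [RHS]eq_bigr do rewrite expr2 big_distrlr/=.
  rewrite [RHS]exchange_big/=; apply: eq_big_seq => a sa.
  rewrite [RHS]exchange_big/=; apply: eq_big_seq => b sb.
  have [cla _] := clP a sa.
  rewrite (bigD1 (Ordinal cla))//= eqxx mul1r big1 ?addr0 => [|k].
    by rewrite (eE a b)// eq_sym mulrCA.
  by rewrite -val_eqE/= eq_sym => /negbTE ->; rewrite !mul0r.
by apply: sumr_ge0 => k _; rewrite sqr_ge0.
Qed.

(** * Lattice coordinates and exhaustion by finite boxes *)

Lemma lattice_coordinates (R : realType) (n : nat) (b : n.-tuple 'rV[R]_n) :
  free b -> exists d : 'I_n -> 'rV[R]_n, forall (z : 'I_n -> int) i,
    (z i)%:~R = dotv (\sum_(j < n) tnth b j *~ z j) (d i).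
Proof.
move=> b_free; pose B := \matrix_(i < n) tnth b i.
have latE z : \sum_(j < n) tnth b j *~ z j = (\row_j (z j)%:~R) *m B.
  by rewrite mulmx_sum_row; apply: eq_bigr => j _; rewrite mxE rowK scaler_int.
have B_unit : B \in unitmx.
  rewrite -row_free_unit; apply: inj_row_free => w.
  rewrite mulmx_sum_row => w0; apply/rowP => i; rewrite mxE.
  move/freeP: b_free; apply; rewrite -[RHS]w0; apply: eq_bigr => j _.
  by rewrite rowK (tnth_nth 0).
(* This is the dual basis: the columns of the inverse of the matrix whose rows are the basis
   vectors. *)
exists (fun i => (col i (invmx B))^T) => z i.
transitivity (((\row_j (z j)%:~R) *m B *m invmx B) 0 i).
  by rewrite mulmxK// mxE.
by rewrite -latE mxE; apply: eq_bigr => j _; rewrite !mxE.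
Qed.

Lemma is_latticeB (R : realType) (n : nat) (L : set 'rV[R]_n) : is_lattice L ->
  forall x y, L x -> L y -> L (x - y).
Proof.
move=> [b _ ->] _ _ [z _ <-] [t _ <-]; exists (fun i => z i - t i) => //.
by rewrite -sumrB; apply: eq_bigr => i _; rewrite mulrzBr.
Qed.

Lemma is_lattice0 (R : realType) (n : nat) (L : set 'rV[R]_n) :
  is_lattice L -> L 0.
Proof. by move=> [b _ ->]; exists (fun=> 0) => //; rewrite big1. Qed.

Lemma is_latticeD (R : realType) (n : nat) (L : set 'rV[R]_n) : is_lattice L ->
  forall x y, L x -> L y -> L (x + y).
Proof.
move=> hL x y Lx Ly; have -> : x + y = x - (0 - y) by rewrite sub0r opprK.
by apply: (is_latticeB hL) => //; apply: (is_latticeB hL) => //;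
  exact: is_lattice0.
Qed.

(** [s N] consists of the points with all coordinates z_i in [-N, N). Since z_i^2 <= c |w|^2, the
    product of the 1 + z_i^2 times (1 + |w|^2)^2 is at most K exp(pi |w|^2). Each term of the last
    sum is thus at most K times the product of the 1 / (1 + z_i^2), whose sum over boxes is bounded.
    That last clause is what later yields integrability of functions of growth (1 + |w|^2)^2. *)
Lemma lattice_exhaustion (R : realType) (n : nat) (L : set 'rV[R]_n) :
  is_lattice L -> exists (s : nat -> seq 'rV[R]_n) (C : R),
  [/\ forall N, uniq (s N),
      forall N w, w \in s N -> L w,
      forall w, L w -> \forall N \near \oo, w \in s N &
      forall N, \sum_(w <- s N) (1 + dotv w w) ^+ 2 * rho w <= C].
Proof.
move=> [b b_free ->].
pose lat (z : 'I_n -> int) := \sum_(i < n) tnth b i *~ z i.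
have [d dE] := @lattice_coordinates R n b b_free.
pose z N (A : {ffun 'I_n -> 'I_(N + N)}) i := (A i)%:Z - N%:Z.
pose c : R := \sum_(i < n) dotv (d i) (d i).
have c0 : 0 <= c by apply: sumr_ge0 => i _; exact: dotv_ge0.
(* The exponent is n + 2: one factor for each of the n coordinates and two for (1 + |w|^2)^2. The
   slope 1 + c dominates both c and 1. *)
have [K K0 KP] := @exprn_le_expR R (1 + c) n.+1 (addr_ge0 ler01 c0).
exists (fun N => [seq lat (z N A) | A : {ffun 'I_n -> 'I_(N + N)}]),
  (K * 8 ^+ n).
split=> [N|N w|w [t _ <-]|N].
- rewrite map_inj_uniq ?enum_uniq// => A A' AA'; apply/ffunP => i.
  have : (z N A i)%:~R = (z N A' i)%:~R :> R.
    by rewrite !dE -/(lat _) AA'.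
  by move/intr_inj/addIr => -[] /val_inj.
- by move=> /mapP[A _ ->]; exists (z N A).
(* The box reaches N - 1 but not N, hence the successor, which makes |t_i| < N strict. *)
- exists (\max_(i < n) `|t i|%N).+1 => // N /= tN.
  have tiN i : (`|t i| < N)%N.
    by apply: leq_trans tN; rewrite ltnS; exact: leq_bigmax.
  have tiNN i : (`|(t i + N%:Z)%R| < N + N)%N by have := tiN i; lia.
  apply/mapP; exists [ffun i => Ordinal (tiNN i)]; first by rewrite mem_enum.
  apply: eq_bigr => i _; rewrite /z ffunE/=; congr (_ *~ _).
  by have := tiN i; lia.
rewrite big_map big_enum/=.
apply: (@le_trans _ _ (\sum_A K * \prod_(i < n) (1 + ((z N A i)%:~R) ^+ 2)^-1)).
  apply: ler_sum => A _; set w := lat _; set t := dotv w w.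
  have t0 : 0 <= t := dotv_ge0 w.
  have zt i : ((z N A i)%:~R : R) ^+ 2 <= c * t.
    rewrite dE -/w; apply: le_trans (dotv_CauchySchwarz _ _) _.
    rewrite mulrC ler_wpM2r// /c (bigD1 i)//= lerDl.
    by apply: sumr_ge0 => j _; exact: dotv_ge0.
  have prod_gt0 : 0 < \prod_(i < n) (1 + ((z N A i)%:~R : R) ^+ 2).
    by apply: prodr_gt0 => i _; rewrite ltr_pwDl ?sqr_ge0.
  rewrite rhoE expRN prodfV ler_pdivrMr ?expR_gt0// -mulrA (mulrC _^-1) mulrA.
  rewrite ler_pdivlMr//; apply: le_trans (KP _ t0).
  rewrite -(addn2 n) exprD mulrC; apply: ler_pM.
  - exact: ltW.
  - exact: sqr_ge0.
  - rewrite -[X in _ <= _ ^+ X]card_ord -prodr_const; apply: ler_prod => i _.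
    rewrite addr_ge0 ?sqr_ge0//= lerD2l (le_trans (zt i))//.
    by rewrite ler_wpM2r// lerDr.
  - rewrite lerXn2r ?nnegrE ?addr_ge0 ?mulr_ge0 ?addr_ge0// lerD2l.
    by rewrite ler_peMl// lerDl.
by rewrite -mulr_sumr ler_wpM2l//; exact: sum_box_inv1Dsqr_le.
Qed.

(** * Integration against the discrete Gaussian *)

Lemma sum_seq_delta (R : pzRingType) (T : eqType) (s : seq T) (f : T -> R) x :
  uniq s -> \sum_(w <- s) f w * (x == w)%:R = f x * (x \in s)%:R.
Proof.
move=> s_uniq; have [xs|xs] := boolP (x \in s).
  rewrite (bigD1_seq x)//= eqxx big1 ?addr0// => w.
  by rewrite eq_sym => /negbTE ->; rewrite mulr0.
rewrite mulr0 big_seq big1// => w ws.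
by case: eqP => [xw|_]; [rewrite xw ws in xs | rewrite mulr0].
Qed.

Lemma discrete_measurable_fun (R : realType) (n : nat) d
    (T : measurableType d) (D : set (discrete_rV R n))
    (f : discrete_rV R n -> T) : measurable_fun D f.
Proof. by move=> _ Y _; exact: measurable_discrete_rV. Qed.

(** Fatou's lemma for the truncations of [f] to [s N]: on [L] they are eventually equal to [f], and
    the complement of [L] is null. *)
Lemma ge0_integral_exhaustion_le (R : realType) (n : nat)
    (nu : {measure set (discrete_rV R n) -> \bar R}) (L : set 'rV[R]_n)
    (s : nat -> seq 'rV[R]_n) (f : 'rV[R]_n -> R) (C : \bar R) :
  nu (~` L) = 0%E -> (forall N, uniq (s N)) ->
  (forall N w, w \in s N -> L w) ->
  (forall w, L w -> \forall N \near \oo, w \in s N) ->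
  (forall w, 0 <= f w) ->
  (forall N, (\sum_(w <- s N) (f w)%:E * nu [set w] <= C)%E) ->
  (\int[nu]_w (f w)%:E <= C)%E.
Proof.
move=> nuL s_uniq sL Ls f0 sumC.
pose g N (x : discrete_rV R n) : \bar R :=
  (f x * ((x : 'rV[R]_n) \in s N)%:R)%:E.
have mL : measurable (L : set (discrete_rV R n)).
  exact: measurable_discrete_rV.
have mLC : measurable (~` L : set (discrete_rV R n)).
  exact: measurable_discrete_rV.
rewrite (ge0_negligible_integral mLC)//; last by move=> x _; rewrite lee_fin.
rewrite setTD setCK.
have -> : (\int[nu]_(x in L) (f x)%:E = \int[nu]_(x in L) limn_einf (g^~ x))%E.
  apply: eq_integral => x /set_mem Lx.
  rewrite (@cvg_limn_einf_sup _ _ (f x)%:E _).1//.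
  apply: cvg_near_cst; near=> N; rewrite /g.
  have -> : (x : 'rV[R]_n) \in s N by near: N; exact: Ls.
  by rewrite mulr1.
have g0 N (x : discrete_rV R n) : L x -> (0 <= g N x)%E.
  by rewrite lee_fin mulr_ge0.
have mg N : measurable_fun (L : set (discrete_rV R n)) (g N).
  exact: discrete_measurable_fun.
have g_fatou := @fatou _ _ _ nu L mL g mg g0.
apply: (le_trans g_fatou).
rewrite limn_einf_lim; apply: lime_le; first exact: is_cvg_einfs.
apply: nearW => N.
apply: (@le_trans _ _ (\int[nu]_(x in L) g N x)%E).
  by apply: ereal_inf_lbound; exists N => /=.
apply: le_trans (sumC N); rewrite le_eqVlt; apply/orP; left; apply/eqP.
(* A truncation is a finite combination of indicators of points, so its integral is the finite sum
   bounded by hypothesis. *)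
transitivity (\int[nu]_(x in L) \sum_(w <- s N) (f w)%:E * (\1_[set w] x)%:E)%E.
  apply: eq_integral => x _; rewrite /g -sum_seq_delta// -sumEFin.
  by apply: eq_bigr => w _; rewrite EFinM indicE classical_sets.in_set1.
rewrite ge0_integral_sum//; last by move=> w x _; rewrite mule_ge0// lee_fin.
apply: eq_big_seq => w ws; rewrite ge0_integralZl_EFin//.
by rewrite integral_indic// (setIidl _)// => _ ->; exact: sL ws.
Unshelve. all: by end_near. Qed.

Section discrete_gaussian_theory.
Context (R : realType) (n : nat) (L : set 'rV[R]_n).
Context (hL : is_lattice L).
Local Notation T := (discrete_rV R n).
Local Notation P := (@discrete_gaussian R n L).

(** The exhaustion bounds the mass of [L] from above and the origin makes it positive, so
    [mnormalize] does not take its Dirac default and K is the inverse of that mass. *)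
Lemma discrete_gaussianE : exists2 K : R, 0 < K &
  forall A : set T, P A = (rho_set (A `&` (L : set T)) * K%:E)%E.
Proof.
have [s [C [s_uniq sL Ls sC]]] := lattice_exhaustion hL.
pose mu : {measure set T -> \bar R} :=
  mrestr (@rho_set R n) (measurable_discrete_rV L).
have muE (A : set T) : mu A = rho_set (A `&` (L : set T)) by [].
have mu1 (w : 'rV[R]_n) : L w -> mu [set w] = (rho w)%:E.
  move=> Lw; rewrite muE (setIidl _); last by move=> _ ->.
  by rewrite /rho_set esum_set1// lee_fin ltW// rho_gt0.
have muT_le : (mu setT <= C%:E)%E.
  rewrite -[mu setT]mul1e -integral_cst//.
  apply: (@ge0_integral_exhaustion_le R n mu L s (cst 1)) => //.
    by rewrite muE setICl measure0.
  move=> N; apply: (@le_trans _ _ (\sum_(w <- s N) (rho w)%:E)%E).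
    rewrite le_eqVlt; apply/orP; left; apply/eqP; apply: eq_big_seq => w ws.
    by rewrite mul1e mu1//; exact: sL ws.
  rewrite sumEFin lee_fin; apply: le_trans (sC N).
  apply: ler_sum => w _; rewrite ler_peMl ?(ltW (rho_gt0 w))//.
  by rewrite exprn_ege1// lerDl dotv_ge0.
have muT_gt0 : (0 < mu setT)%E.
  apply: (@lt_le_trans _ _ (mu [set (0 : 'rV[R]_n)])).
    by rewrite mu1 ?lte_fin ?rho_gt0//; exact: is_lattice0.
  by apply: le_measure; rewrite ?inE//; exact: measurable_discrete_rV.
have muT_fin : mu setT \is a fin_num.
  by rewrite ge0_fin_numE ?(le_lt_trans muT_le) ?ltry// ltW.
exists (fine (mu setT))^-1.
  by rewrite invr_gt0 fine_gt0// muT_gt0 -ge0_fin_numE// ltW.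
move=> A; rewrite /discrete_gaussian /= /mnormalize.
rewrite (gt_eqF muT_gt0) ifF//=; apply: lt_eqF.
by rewrite -ge0_fin_numE// ltW.
Qed.

Lemma discrete_gaussian_setC : P (~` (L : set T)) = 0%E.
Proof.
by have [K _ ->] := discrete_gaussianE; rewrite setICl measure0 mul0e.
Qed.

Lemma discrete_gaussian_set1 : exists2 K : R, 0 < K &
  forall w : 'rV[R]_n, L w -> P [set w] = (rho w * K)%:E.
Proof.
have [K K0 PE] := discrete_gaussianE; exists K => // w Lw.
rewrite PE (setIidl _); last by move=> _ ->.
by rewrite /rho_set esum_set1 ?EFinM// lee_fin ltW// rho_gt0.
Qed.

(** The allowed growth is exactly the weight whose Gaussian sums over [s N] are bounded in
    [lattice_exhaustion]. *)
Lemma integrable_discrete_gaussian (f : T -> R) (M : R) :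
  (forall y, `|f y| <= M * (1 + dotv y y) ^+ 2) ->
  P.-integrable setT (EFin \o f).
Proof.
move=> fM; have [s [C [s_uniq sL Ls sC]]] := lattice_exhaustion hL.
have [K K0 P1] := discrete_gaussian_set1.
apply/integrableP; split; first exact: discrete_measurable_fun.
apply: (@le_lt_trans _ _ (M * C * K)%:E); last exact: ltry.
apply: (@ge0_integral_exhaustion_le R n P L s (fun y => `|f y|)) => //.
  exact: discrete_gaussian_setC.
move=> N; have M0 : 0 <= M.
  have := le_trans (normr_ge0 _) (fM (0 : 'rV[R]_n)).
  by rewrite pmulr_lge0// exprn_gt0// ltr_pwDl// dotv_ge0.
apply: (@le_trans _ _
  (\sum_(w <- s N) (M * (1 + dotv w w) ^+ 2 * (rho w * K))%:E)%E).
  rewrite big_seq [leRHS]big_seq; apply: lee_sum => w ws.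
  rewrite [X in (_ * X <= _)%E](P1 w (sL _ _ ws)).
  by rewrite -EFinM lee_fin ler_wpM2r// mulr_ge0// ltW// rho_gt0.
rewrite sumEFin lee_fin; under eq_bigr do rewrite mulrA.
rewrite -mulr_suml ler_pM2r//; under eq_bigr do rewrite -mulrA.
by rewrite -mulr_sumr ler_wpM2l.
Qed.

Lemma expectation_discrete_gaussian (f : T -> R) (M : R) :
  (forall y, `|f y| <= M * (1 + dotv y y) ^+ 2) ->
  'E_P[f]%E = (\int[P]_y f y)%:E.
Proof.
move=> fM; rewrite unlock /Rintegral fineK//.
exact: integrable_fin_num (integrable_discrete_gaussian fM).
Qed.

(** Dominated convergence; pointwise convergence on [L] suffices because the complement of [L] has
    probability zero. *)
Lemma cvg_discrete_gaussian (f_ : nat -> T -> R) (f : T -> R) (M : R) :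
  (forall N y, `|f_ N y| <= M * (1 + dotv y y) ^+ 2) ->
  (forall y, L y -> f_ N y @[N --> \oo] --> f y) ->
  \int[P]_y f_ N y @[N --> \oo] --> \int[P]_y f y.
Proof.
move=> f_M f_f; apply: fine_cvg.
have gM : P.-integrable setT
    (EFin \o (fun y : T => M * (1 + dotv y y) ^+ 2)).
  apply: (@integrable_discrete_gaussian _ M) => y.
  by rewrite ger0_norm// (le_trans _ (f_M 0%N y)).
have f_f_ae : {ae P, forall y, setT y -> (f_ N y)%:E @[N --> \oo] --> (f y)%:E}.
  exists (~` L); split; [exact: measurable_discrete_rV|
    exact: discrete_gaussian_setC|].
  move=> y /= + Ly; apply => _; apply: cvg_EFin; first exact: nearW.
  exact: f_f.
have f_g_ae : {ae P, forall y N, setT y ->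
    (`|(f_ N y)%:E| <= (M * (1 + dotv y y) ^+ 2)%:E)%E}.
  by apply: aeW => y N _ /=; rewrite lee_fin.
have [|fi _ cvg_int] := dominated_convergence measurableT
  (fun N => @discrete_measurable_fun _ _ _ _ _ _) _ f_f_ae gM f_g_ae.
  exact: discrete_measurable_fun.
by rewrite fineK//; exact: (integrable_fin_num measurableT fi).
Qed.

(** Points off the lattice are included because the formula is applied to half-sums and
    half-differences of lattice vectors, which may leave [L]. *)
Lemma Rintegral_discrete_gaussian_delta : exists2 K : R, 0 < K &
  forall w : 'rV[R]_n,
    \int[P]_y ((y : 'rV[R]_n) == w)%:R = `[< L w >]%:R * (rho w * K).
Proof.
have [K K0 P1] := discrete_gaussian_set1; exists K => // w.
have -> : \int[P]_y ((y : 'rV[R]_n) == w)%:R = fine (P [set w]).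
  rewrite -[[set w]]setIT -integral_indic//; congr fine.
  by apply: eq_integral => y _; rewrite indicE classical_sets.in_set1.
have [Lw|nLw] := pselect (L w); first by rewrite P1// asboolT// mul1r.
rewrite asboolF// mul0r; have [K' _ ->] := discrete_gaussianE.
rewrite (_ : [set w] `&` _ = set0) ?measure0 ?mul0e//.
by apply/seteqP; split => // y [/= ->].
Qed.

End discrete_gaussian_theory.

(** * Moments up to order four and their growth bounds *)

Section moments.
Context (R : realType) (n : nat) (L : set 'rV[R]_n) (hL : is_lattice L).
Context (u v : 'rV[R]_n).
Local Notation T := (discrete_rV R n).
Local Notation P := (@discrete_gaussian R n L).
Let k : R := 1 + dotv u u + dotv v v.
Let q (y : 'rV[R]_n) : R := 1 + dotv y y.

Let q_ge1 y : 1 <= q y.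
Proof. by rewrite lerDl dotv_ge0. Qed.

Let k_ge1 : 1 <= k.
Proof. by rewrite /k -addrA lerDl addr_ge0 ?dotv_ge0. Qed.

Lemma dotv_sqr_bounds y :
  [/\ dotv y u ^+ 2 <= k * q y, dotv y v ^+ 2 <= k * q y &
      `|dotv y u * dotv y v| <= k * q y].
Proof.
have hu := dotv_CauchySchwarz y u; have hv := dotv_CauchySchwarz y v.
have u0 := dotv_ge0 u; have v0 := dotv_ge0 v; have y0 := dotv_ge0 y.
have hU : dotv y u ^+ 2 <= k * q y by apply: (le_trans hu); rewrite /k /q; nra.
have hV : dotv y v ^+ 2 <= k * q y by apply: (le_trans hv); rewrite /k /q; nra.
split => //; rewrite ler_norml.
(* These two squares give |ab| <= (a^2 + b^2) / 2 for a = <y,u> and b = <y,v>. *)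
have h1 := sqr_ge0 (dotv y u - dotv y v).
have h2 := sqr_ge0 (dotv y u + dotv y v).
by apply/andP; split; nra.
Qed.

Let q_le_sqr y : q y <= q y ^+ 2.
Proof. by rewrite expr2 ler_peMl// (le_trans _ (q_ge1 y)). Qed.

Let k0 : 0 <= k. Proof. exact: le_trans k_ge1. Qed.

Let kq_le y : k * q y <= k ^+ 2 * q y ^+ 2.
Proof.
by apply: ler_pM => //; [exact: le_trans (q_ge1 y)|rewrite expr2 ler_peMl].
Qed.

Lemma moment22_bound y : `|dotv y u ^+ 2 * dotv y v ^+ 2| <= k ^+ 2 * q y ^+ 2.
Proof.
have [hu hv _] := dotv_sqr_bounds y.
rewrite normrM !ger0_norm ?sqr_ge0// -[leRHS]exprMn [leRHS]expr2.
by apply: ler_pM; rewrite ?sqr_ge0.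
Qed.

Lemma moment20_bound y : `|dotv y u ^+ 2| <= k ^+ 2 * q y ^+ 2.
Proof.
have [hu _ _] := dotv_sqr_bounds y.
by rewrite ger0_norm ?sqr_ge0//; apply: le_trans (kq_le y).
Qed.

Lemma moment02_bound y : `|dotv y v ^+ 2| <= k ^+ 2 * q y ^+ 2.
Proof.
have [_ hv _] := dotv_sqr_bounds y.
by rewrite ger0_norm ?sqr_ge0//; apply: le_trans (kq_le y).
Qed.

Lemma moment11_bound y : `|dotv y u * dotv y v| <= k ^+ 2 * q y ^+ 2.
Proof. by have [_ _ h] := dotv_sqr_bounds y; apply: le_trans (kq_le y). Qed.

Let cst_bound (c : R) (y : 'rV[R]_n) : `|c| <= `|c| * q y ^+ 2.
Proof. by rewrite ler_peMr// exprn_ege1. Qed.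

(** The rotated product has this shape in y for fixed x, and its integral over y has the same shape
    in x, so one linearity formula serves for both integrations. *)
Lemma Rintegral_moments (c0 c1 c2 c3 c4 : R) :
  \int[P]_y (c0 + c1 * (dotv y u ^+ 2 * dotv y v ^+ 2) + c2 * dotv y u ^+ 2
    + c3 * dotv y v ^+ 2 + c4 * (dotv y u * dotv y v)) =
  c0 + c1 * \int[P]_y (dotv y u ^+ 2 * dotv y v ^+ 2)
    + c2 * \int[P]_y (dotv y u ^+ 2) + c3 * \int[P]_y (dotv y v ^+ 2)
    + c4 * \int[P]_y (dotv y u * dotv y v).
Proof.
have i1 := integrable_discrete_gaussian hL moment22_bound.
have i2 := integrable_discrete_gaussian hL moment20_bound.
have i3 := integrable_discrete_gaussian hL moment02_bound.
have i4 := integrable_discrete_gaussian hL moment11_bound.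
have i0 := integrable_discrete_gaussian hL (cst_bound c0).
have iZ (c : R) (f : T -> R) : P.-integrable setT (EFin \o f) ->
  P.-integrable setT (EFin \o (fun y => c * f y)) by exact: integrableZl.
have iD (f g : T -> R) : P.-integrable setT (EFin \o f) ->
  P.-integrable setT (EFin \o g) ->
  P.-integrable setT (EFin \o (fun y => f y + g y)) by exact: integrableD.
rewrite !RintegralD ?RintegralZl ?Rintegral_cst//=;
  do ?[apply: (iD)|apply: (iZ)] => //.
by rewrite probability_setT/= mulr1.
Qed.

Definition centered_prod (m : R) (a : 'rV[R]_n) : R := dotv a u * dotv a v - m.

(** The quartic part is (<x,u>^2 - <y,u>^2)(<x,v>^2 - <y,v>^2), and the terms mixing x and y cancel
    in the part linear in m. The result is arranged as a polynomial in y to match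
    [Rintegral_moments]. *)
Lemma centered_prod_rotation m (x y : 'rV[R]_n) :
  centered_prod m (x + y) * centered_prod m (x - y) =
  (dotv x u ^+ 2 * dotv x v ^+ 2 - 2 * m * (dotv x u * dotv x v) + m ^+ 2)
  + 1 * (dotv y u ^+ 2 * dotv y v ^+ 2) + (- dotv x v ^+ 2) * dotv y u ^+ 2
  + (- dotv x u ^+ 2) * dotv y v ^+ 2 + (- (2 * m)) * (dotv y u * dotv y v).
Proof. by rewrite /centered_prod !dotvBl !dotvDl; ring. Qed.

(** By the parallelogram law |x + y|^2 and |x - y|^2 are at most 2 (|x|^2 + |y|^2), so each factor
    is at most a constant times q(x) q(y). A bound that separates the variables allows dominated
    convergence in each of them in turn. *)
Lemma centered_prod_rotation_bound m (x y : 'rV[R]_n) :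
  `|centered_prod m (x + y) * centered_prod m (x - y)| <=
  (2 * k ^+ 2 + `|m|) ^+ 2 * q x ^+ 2 * q y ^+ 2.
Proof.
have prod_le (z : 'rV[R]_n) : dotv z z <= 2 * (dotv x x + dotv y y) ->
    `|centered_prod m z| <= (2 * k ^+ 2 + `|m|) * (q x * q y).
  move=> zxy; apply: (le_trans (ler_normB _ _)); rewrite mulrDl; apply: lerD.
    have [_ _ /le_trans] := dotv_sqr_bounds z; apply.
    have hx := dotv_ge0 x; have hy := dotv_ge0 y; have k1 := k_ge1.
    apply: (@le_trans _ _ (k * (2 * (q x * q y)))).
      by rewrite ler_wpM2l// /q; nra.
    by rewrite mulrA ler_wpM2r ?mulr_ge0// ?(le_trans _ (q_ge1 _))//; nra.
  by rewrite ler_peMr// -[1]mulr1 ler_pM.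
have -> : (2 * k ^+ 2 + `|m|) ^+ 2 * q x ^+ 2 * q y ^+ 2 =
  (2 * k ^+ 2 + `|m|) * (q x * q y) * ((2 * k ^+ 2 + `|m|) * (q x * q y)).
  by ring.
rewrite normrM; apply: ler_pM => //; apply: prod_le;
  by rewrite -dotv_parallelogram ?lerDl ?lerDr dotv_ge0.
Qed.

End moments.

(** * Positivity after the change of variables (x + y, x - y) *)

Section rotation.
Context (R : realType) (n : nat) (L : set 'rV[R]_n) (hL : is_lattice L).
Local Notation T := (discrete_rV R n).
Local Notation P := (@discrete_gaussian R n L).
Implicit Types (x y a b : 'rV[R]_n).

Lemma integrable_delta (c : R) x :
  P.-integrable setT (EFin \o (fun y : T => c * ((y : 'rV[R]_n) == x)%:R)).
Proof.
apply: (@integrable_discrete_gaussian _ _ _ hL _ `|c|) => y.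
rewrite normrM ler_wpM2l// ger0_norm//.
by rewrite (@le_trans _ _ 1)// ?lern1 ?leq_b1// exprn_ege1// lerDl dotv_ge0.
Qed.

Lemma Rintegral_sum_delta (I : Type) (r : seq I) (c : I -> R)
    (x : I -> 'rV[R]_n) :
  \int[P]_y (\sum_(i <- r) c i * ((y : 'rV[R]_n) == x i)%:R) =
  \sum_(i <- r) c i * \int[P]_y ((y : 'rV[R]_n) == x i)%:R.
Proof.
have int_sum r' : P.-integrable setT (EFin \o
    (fun y : T => \sum_(i <- r') c i * ((y : 'rV[R]_n) == x i)%:R)).
  rewrite (_ : _ \o _ = fun y : T =>
      (\sum_(i <- r') (c i * ((y : 'rV[R]_n) == x i)%:R)%:E)%E).
    by apply: integrable_sum => // i _; exact: integrable_delta.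
  by apply/funext => y /=; rewrite sumEFin.
elim: r => [|i r IHr].
  under eq_Rintegral do rewrite big_nil.
  by rewrite Rintegral_cst// big_nil mul0r.
under eq_Rintegral do rewrite big_cons.
rewrite RintegralD//; last exact: integrable_delta.
rewrite IHr big_cons RintegralZl//.
by under eq_fun do rewrite -[_%:R]mul1r; exact: integrable_delta.
Qed.

(** The cutoff reduces the double integral to a finite sum over pairs (a, b) from [s], which is a
    quadratic form to which [equiv_quadratic_ge0] applies. *)
Lemma rotated_sum_ge0 (g : 'rV[R]_n -> R) (s : seq 'rV[R]_n) : uniq s ->
  (forall w, w \in s -> L w) ->
  0 <= \int[P]_x \int[P]_y
    (g (x + y) * g (x - y) * ((x + y \in s)%:R * (x - y \in s)%:R)).
Proof.
move=> s_uniq sL; have [K K0 PE] := Rintegral_discrete_gaussian_delta hL.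
pose r := [seq (a, b) | a <- s, b <- s].
(* [X] and [Y] invert the map (x, y) -> (x + y, x - y). *)
pose X (i : 'rV[R]_n * 'rV[R]_n) := 2^-1 *: (i.1 + i.2).
pose Y (i : 'rV[R]_n * 'rV[R]_n) := 2^-1 *: (i.1 - i.2).
have half z : 2^-1 *: (z + z) = z :> 'rV[R]_n.
  by rewrite -[z + z]mulr2n -[z *+ 2]scaler_nat scalerA mulVf ?scale1r//.
have XYD i : X i + Y i = i.1 by rewrite -scalerDr addrACA subrr addr0 half.
have XYB i : X i - Y i = i.2.
  by rewrite -scalerBr opprB [i.1 + _]addrC addrACA subrr addr0 half.
have deltaE x y i : ((x == X i) && (y == Y i)) =
    ((x + y == i.1) && (x - y == i.2)).
  apply/andP/andP => -[/eqP xE /eqP yE].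
    by rewrite xE yE XYD XYB !eqxx.
  rewrite /X /Y -xE -yE addrACA subrr addr0 half opprB.
  by rewrite [x + y]addrC addrACA subrr addr0 half !eqxx.
have FE x y : g (x + y) * g (x - y) * ((x + y \in s)%:R * (x - y \in s)%:R) =
    \sum_(i <- r) (g i.1 * g i.2 * (x == X i)%:R) * (y == Y i)%:R.
  rewrite mulrACA -!sum_seq_delta// big_distrlr big_allpairs/=.
  apply: eq_bigr => a _; apply: eq_bigr => b _.
  by rewrite -[RHS]mulrA -natrM mulnb (deltaE _ _ (a, b)) -mulnb natrM mulrACA.
under eq_Rintegral => x _.
  under eq_Rintegral do rewrite FE.
  rewrite Rintegral_sum_delta.
  under eq_bigr do rewrite mulrAC.
  over.
rewrite Rintegral_sum_delta big_allpairs/=.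
(* [h] absorbs into [g] the share of the Gaussian weight carried by a, and [e] below is congruence
   mod 2L on [s]. *)
pose h a := g a * expR (- (pi * (dotv a a / 2))).
pose e a b := `[< L (Y (a, b)) >].
have -> : \sum_(a <- s) \sum_(b <- s) g a * g b *
      (\int[P]_y ((y : 'rV[R]_n) == Y (a, b))%:R) *
      (\int[P]_y ((y : 'rV[R]_n) == X (a, b))%:R) =
    K ^+ 2 * \sum_(a <- s) \sum_(b <- s) (e a b)%:R * (h a * h b).
  rewrite mulr_sumr; apply: eq_big_seq => a sa.
  rewrite mulr_sumr; apply: eq_big_seq => b sb.
  rewrite !PE /e; have [LY|nLY] := pselect (L (Y (a, b))); last first.
    by rewrite (asboolF nLY) !mul0r !mulr0 mul0r.
  (* Once the half-difference is in [L], so is the half-sum, which differs from it by b; one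
     membership condition therefore covers both. *)
  have LX : L (X (a, b)).
    have -> : X (a, b) = Y (a, b) + b.
      by rewrite -[X in _ + X](XYB (a, b)) addrCA subrr addr0.
    by apply: is_latticeD => //; exact: sL.
  rewrite (asboolT LX) (asboolT LY) !mul1r /h !rhoE.
  (* This is |X|^2 + |Y|^2 = (|a|^2 + |b|^2) / 2, solved for the factor in a so that [field] can
     cancel the factor in b. *)
  have -> : expR (- (pi * (dotv a a / 2))) =
      expR (- (pi * dotv (X (a, b)) (X (a, b)))) *
      expR (- (pi * dotv (Y (a, b)) (Y (a, b)))) /
      expR (- (pi * (dotv b b / 2))).
    rewrite -expRD -expRN -expRD; congr expR.
    have := dotv_parallelogram (X (a, b)) (Y (a, b)).
    by rewrite XYD XYB/= => ab; rewrite -[dotv a a](addrK (dotv b b)) ab; field.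
  by field; rewrite gt_eqF ?expR_gt0.
rewrite mulr_ge0 ?sqr_ge0//; apply: equiv_quadratic_ge0 => a b c; split.
  by apply/asboolP; rewrite /Y subrr scaler0; exact: is_lattice0.
move=> /asboolP Lab; apply/asboolP/asboolP => [Lac|Lbc].
  have -> : Y (b, c) = Y (a, c) - Y (a, b).
    rewrite /Y/= -scalerBr opprB; congr (_ *: _).
    by rewrite [RHS]addrC addrA addrNK.
  exact: is_latticeB.
have -> : Y (a, c) = Y (a, b) + Y (b, c).
  by rewrite /Y/= -scalerDr addrA addrNK.
exact: is_latticeD.
Qed.

(** The cutoff of [rotated_sum_ge0] is removed by two dominated convergences, first in y for each x
    in [L] and then in x; integrating the separated bound over y gives the domination for the
    second. *)
Lemma centered_prod_rotation_ge0 (u v : 'rV[R]_n) (m : R) :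
  0 <= \int[P]_x \int[P]_y
    (centered_prod u v m (x + y) * centered_prod u v m (x - y)).
Proof.
have [s [C [s_uniq sL Ls _]]] := lattice_exhaustion hL.
pose q y : R := 1 + dotv y y.
pose M := (2 * (1 + dotv u u + dotv v v) ^+ 2 + `|m|) ^+ 2.
pose F x y := centered_prod u v m (x + y) * centered_prod u v m (x - y).
pose F_ N x y := F x y * ((x + y \in s N)%:R * (x - y \in s N)%:R).
have FM x y : `|F x y| <= M * q x ^+ 2 * q y ^+ 2 :=
    centered_prod_rotation_bound u v m x y.
have F_M N x y : `|F_ N x y| <= M * q x ^+ 2 * q y ^+ 2.
  apply: le_trans (FM x y); rewrite /F_ normrM ler_piMr// -natrM normr_nat.
  by rewrite mulnb lern1 leq_b1.
have inner_cvg x : L x ->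
    \int[P]_y F_ N x y @[N --> \oo] --> \int[P]_y F x y.
  move=> Lx; apply: (cvg_discrete_gaussian hL (F_M ^~ x)) => y Ly.
  apply: cvg_near_cst; near=> N; rewrite /F_.
  have -> : x + y \in s N by near: N; apply: Ls; exact: is_latticeD.
  have -> : x - y \in s N by near: N; apply: Ls; exact: is_latticeB.
  by rewrite !mulr1.
have q_le (y : 'rV[R]_n) : `|q y ^+ 2| <= 1 * q y ^+ 2.
  by rewrite mul1r ger0_norm// sqr_ge0.
have inner_le N x : `|\int[P]_y F_ N x y| <=
    M * \int[P]_y (q y ^+ 2) * q x ^+ 2.
  have iF := integrable_discrete_gaussian hL (F_M N x).
  apply: (le_trans (le_normr_Rintegral measurableT iF)).
  rewrite mulrAC -RintegralZl//; last exact: integrable_discrete_gaussian q_le.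
  apply: le_Rintegral => //.
  - apply: (@integrable_discrete_gaussian _ _ _ hL _ (M * q x ^+ 2)) => y.
    by rewrite normr_id.
  - apply: (@integrable_discrete_gaussian _ _ _ hL _ (M * q x ^+ 2)) => y.
    by rewrite ger0_norm// (le_trans _ (FM x y)).
have outer_cvg := cvg_discrete_gaussian hL inner_le inner_cvg.
rewrite -(cvg_lim _ outer_cvg)//; apply: limr_ge.
  by apply/cvg_ex; eexists; exact: outer_cvg.
by apply: nearW => N;
  exact: (rotated_sum_ge0 (centered_prod u v m) (s_uniq N) (sL N)).
Unshelve. all: by end_near. Qed.

End rotation.

(** * Fourth-moment inequality for the discrete Gaussian *)

Unset Implicit Arguments.
Local Open Scope ereal_scope.

Theorem proposition3p3 (R : realType) (n : nat) (L : set 'rV[R]_n)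
    (hL : is_lattice L) (u v : 'rV[R]_n) :
  'E_(discrete_gaussian L)[fun y => (dotv y u ^+ 2 * dotv y v ^+ 2)%R] >=
  'E_(discrete_gaussian L)[fun y => (dotv y u ^+ 2)%R] *
    'E_(discrete_gaussian L)[fun y => (dotv y v ^+ 2)%R] +
  2%:E * 'E_(discrete_gaussian L)[fun y => (dotv y u * dotv y v)%R] ^+ 2.
Proof.
rewrite (expectation_discrete_gaussian hL (moment22_bound u v)).
rewrite (expectation_discrete_gaussian hL (moment20_bound u v)).
rewrite (expectation_discrete_gaussian hL (moment02_bound u v)).
rewrite (expectation_discrete_gaussian hL (moment11_bound u v)).
(* Since [>=] is a reversed [<=], the product side is met first: B, C, D are the means of <y,u>^2,
   <y,v>^2, <y,u><y,v>, and A is the mean of <y,u>^2 <y,v>^2. *)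
set B := Rintegral _ _ _; set C := Rintegral _ _ _; set D := Rintegral _ _ _.
set A := Rintegral _ _ _.
(* For general m the double integral is 2A - 2BC - 4mD + m^2; m = 2D minimizes it and so gives the
   strongest inequality, 2A - 2BC - 4D^2 >= 0. *)
have := centered_prod_rotation_ge0 hL u v (2 * D)%R.
have inner (x : 'rV[R]_n) : (\int[discrete_gaussian L]_y
      (centered_prod u v (2 * D) (x + y) * centered_prod u v (2 * D) (x - y)) =
    (2 * D) ^+ 2 + A - 2 * (2 * D) * D
      + 1 * (dotv x u ^+ 2 * dotv x v ^+ 2) + (- C) * dotv x u ^+ 2
      + (- B) * dotv x v ^+ 2 + (- (2 * (2 * D))) * (dotv x u * dotv x v))%R.
  under eq_Rintegral do rewrite centered_prod_rotation.
  by rewrite Rintegral_moments// -/A -/B -/C -/D; ring.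
under eq_Rintegral do rewrite inner.
rewrite Rintegral_moments// -/A -/B -/C -/D => h.
by rewrite -!EFin_expe -!EFinM -EFinD lee_fin; nra.
Qed.
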